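(* If $f\colon[m]^n\to\{0,1\}$ is $\varepsilon$-far from monotone with respect to the uniform measure $U^{\otimes n}$, then \[\mathbb{E}_{x\in[m]^n}\left[\sqrt{s_f^{-}(x)}\right]\ge \Omega\left(\frac{\varepsilon}{m^3\log(mn/\varepsilon)^2}\right),\] where $x$ is uniform on $[m]^n$ and the implied constant is absolute.
   Context: $[m]=\{0,\ldots,m-1\}$; $[m]^n$ has the coordinatewise partial order; $f$ is monotone if $x\le y\Rightarrow f(x)\le f(y)$; $f$ is $\varepsilon$-far from monotone w.r.t. $\mu$ if $\min_{g\text{ monotone}}\mu(\{f\ne g\})\ge\varepsilon$. The negative sensitivity $s_f^-(x)$ is the number of coordinates $i\in\{1,\dots,n\}$ for which there is $y\in[m]^n$ differing from $x$ only in coordinate $i$ such that the pair $(x,y)$ violates monotonicity, i.e. either $x<y$ and $f(x)>f(y)$, or $x>y$ and $f(x)<f(y)$. *)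

(* Defs.v *)
From HB Require Import structures.
From mathcomp Require Export all_boot all_order all_algebra.
From mathcomp Require Export reals exp.

Set Implicit Arguments.
Unset Strict Implicit.
Unset Printing Implicit Defensive.

Import Order.TTheory GRing.Theory Num.Theory.

Local Open Scope ring_scope.

Definition cube (m n : nat) : finType := {ffun 'I_n -> 'I_m}.

Definition cube_le (m n : nat) (x y : cube m n) : bool :=
  [forall i, (x i <= y i)%N].

Definition cube_lt (m n : nat) (x y : cube m n) : bool :=
  (x != y) && cube_le x y.

(* Boolean-valued functions: values are compared in nat, with false as 0 and
   true as 1. *)
Definition monotone (m n : nat) (f : {ffun cube m n -> bool}) : bool :=
  [forall x, forall y, cube_le x y ==> (f x <= f y)%N].

Definition uniform (R : realType) (m : nat) : 'I_m -> R := fun=> m%:R^-1.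

Definition prod_mass (R : realType) (m n : nat) (nu : 'I_m -> R) :
  cube m n -> R := fun x => \prod_(i < n) nu (x i).

Definition meas (R : realType) (T : finType) (mu : T -> R) (A : {set T}) : R :=
  \sum_(x in A) mu x.

Definition expect (R : realType) (T : finType) (mu : T -> R) (F : T -> R) : R :=
  \sum_x mu x * F x.

Definition disagreement (R : realType) (m n : nat) (mu : cube m n -> R)
    (f g : {ffun cube m n -> bool}) : R :=
  meas mu [set x | f x != g x].

(* The minimum over all monotone g; the constant function false, which is
   monotone, only witnesses that the range of the minimum is nonempty. *)
Definition dist_monotone (R : realType) (m n : nat) (mu : cube m n -> R)
    (f : {ffun cube m n -> bool}) : R :=
  disagreement mu f
    [arg min_(g < [ffun=> false] | monotone g) disagreement mu f g]%O.

Definition far_from_monotone (R : realType) (m n : nat) (mu : cube m n -> R)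
    (eps : R) (f : {ffun cube m n -> bool}) : Prop :=
  eps <= dist_monotone mu f.

Definition violates (m n : nat) (f : {ffun cube m n -> bool})
    (x y : cube m n) : bool :=
  (cube_lt x y && (f y < f x)%N) || (cube_lt y x && (f x < f y)%N).

(* Requiring y i != x i is unnecessary: a violating pair is strictly
   comparable, so y differs from x. *)
Definition neg_sensitivity (m n : nat) (f : {ffun cube m n -> bool})
    (x : cube m n) : nat :=
  #|[set i : 'I_n | [exists y : cube m n,
       [forall j, (j != i) ==> (y j == x j)] && violates f x y]]|.

Lemma monotone_false (m n : nat) : monotone [ffun _ : cube m n => false].
Proof.
by apply/forallP => x; apply/forallP => y; rewrite !ffunE implybT.
Qed.

Lemma dist_monotone_le (R : realType) (m n : nat) (mu : cube m n -> R)
    (f g : {ffun cube m n -> bool}) :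
  monotone g -> dist_monotone mu f <= disagreement mu f g.
Proof.
move=> mg; rewrite /dist_monotone.
by case: Order.TotalTheory.arg_minP => [|h _]; [exact: monotone_false|apply].
Qed.

Lemma dist_monotone_attained (R : realType) (m n : nat) (mu : cube m n -> R)
    (f : {ffun cube m n -> bool}) :
  exists2 g, monotone g & dist_monotone mu f = disagreement mu f g.
Proof.
rewrite /dist_monotone; case: Order.TotalTheory.arg_minP => [|h mh _].
  exact: monotone_false.
by exists h.
Qed.

(* Main.v *)
(* For a set [S] of directions let [T_S f] be [f] with all lines in the directions
   of [S] sorted, one direction after the other in a fixed order. For a fixed
   point [x], [S |-> T_S f x] is a Boolean function on the cube of subsets, to which
   an undirected Talagrand inequality, E sqrt(sensitivity) >= 2 p (1 - p), applies.
   Replacing one direction at a time, one sees that for each fixed [S] the sum over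
   [x] of sqrt(sensitivity at S) is at most the sum of sqrt(s_f^-(x)): sorting a
   line is a composition of comparators on two points, and a comparator either
   swaps the two sensitivities, or lowers both, or makes the pair more unequal, so
   that the sum of the square roots does not grow.
     Consequently [T_S f] and [T_(S^c) f] are close on average, so that [T_S f] is
   close to [T_(S^c) T_S f], because [T_(S^c)] is a contraction fixing [T_(S^c) f].
   Applying this along a random order of the directions, whose prefixes are halved
   about log(n / eps) times, shows that [f] is close to the function sorted in all
   directions, which is monotone, unless E sqrt(s_f^-) >= c eps / log(n / eps). *)
Require Import Defs.
From mathcomp Require Import all_boot all_order all_algebra.
From mathcomp Require Import reals exp.
From mathcomp Require Import zify ring lra.

Set Implicit Arguments.
Unset Strict Implicit.
Unset Printing Implicit Defensive.

Import Order.TTheory GRing.Theory Num.Theory.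

Local Open Scope ring_scope.

Notation boolfun m n := {ffun cube m n -> bool}.

(** * Changing one coordinate, and comparators along one direction *)

Definition upd (m n : nat) (x : cube m n) (i : 'I_n) (a : 'I_m) : cube m n :=
  [ffun j => if j == i then a else x j].

Lemma updE (m n : nat) (x : cube m n) i a j :
  upd x i a j = if j == i then a else x j.
Proof. by rewrite ffunE. Qed.

Lemma upd_id (m n : nat) (x : cube m n) i a : x i = a -> upd x i a = x.
Proof. by move=> <-; apply/ffunP=> j; rewrite updE; case: eqP => // ->. Qed.

Lemma upd_upd (m n : nat) (x : cube m n) i a b :
  upd (upd x i a) i b = upd x i b.
Proof. by apply/ffunP=> j; rewrite !updE; case: eqP. Qed.

Lemma updC (m n : nat) (x : cube m n) i j a b :
  i != j -> upd (upd x i a) j b = upd (upd x j b) i a.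
Proof.
move=> ij; apply/ffunP=> k; rewrite !updE.
by case: eqP => // ->; rewrite eq_sym (negbTE ij).
Qed.

Definition comparator (m n : nat) (i : 'I_n) (a b : 'I_m) (h : boolfun m n) :
    boolfun m n :=
  [ffun x : cube m n => if x i == a then h x && h (upd x i b)
             else if x i == b then h (upd x i a) || h x else h x].

Lemma comparatorE (m n : nat) i (a b : 'I_m) (h : boolfun m n) (x : cube m n) :
  comparator i a b h x = if x i == a then h x && h (upd x i b)
                         else if x i == b then h (upd x i a) || h x else h x.
Proof. by rewrite ffunE. Qed.

Lemma comparator_lo (m n : nat) i (a b : 'I_m) (h : boolfun m n) (x : cube m n) :
  x i = a -> comparator i a b h x = h x && h (upd x i b).
Proof. by move=> xa; rewrite ffunE xa eqxx. Qed.

Lemma comparator_hi (m n : nat) i (a b : 'I_m) (h : boolfun m n) (x : cube m n) :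
  (a < b)%N -> x i = a -> comparator i a b h (upd x i b) = h x || h (upd x i b).
Proof.
move=> ab xa; rewrite ffunE updE eqxx -val_eqE gtn_eqF //= eqxx upd_upd.
by rewrite (upd_id xa).
Qed.

Lemma comparator_other (m n : nat) i (a b : 'I_m) (h : boolfun m n) (x : cube m n) :
  x i != a -> x i != b -> comparator i a b h x = h x.
Proof. by move=> xa xb; rewrite ffunE (negbTE xa) (negbTE xb). Qed.

(** * Sums over the pairs of points joined by a comparator *)

Definition coord_swap (m n : nat) (i : 'I_n) (a b : 'I_m) (x : cube m n) :=
  if x i == a then upd x i b else if x i == b then upd x i a else x.

Lemma coord_swapK (m n : nat) (i : 'I_n) (a b : 'I_m) :
  involutive (@coord_swap m n i a b).
Proof.
move=> x; rewrite /coord_swap; case: (eqVneq (x i) a) => [xa|xa].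
  rewrite !updE eqxx; case: eqP => [ba|_]; last by rewrite eqxx upd_upd upd_id.
  by rewrite upd_upd upd_id // ba.
case: (eqVneq (x i) b) => [xb|xb]; last by rewrite (negbTE xa) (negbTE xb).
by rewrite !updE !eqxx upd_upd upd_id.
Qed.

(** [coord_swap] is an involution, so twice a sum over the cube is the sum of [F x + F (s x)], and
    an inequality on each pair suffices. *)
Lemma ler_sum_paired (R : realType) (m n : nat) (i : 'I_n) (a b : 'I_m)
    (G G' : cube m n -> R) :
  (forall x : cube m n, x i = a -> G' x + G' (upd x i b) <= G x + G (upd x i b)) ->
  (forall x : cube m n, x i != a -> x i != b -> G' x <= G x) ->
  \sum_x G' x <= \sum_x G x.
Proof.
move=> Hab Ho; set s := coord_swap i a b.
have dbl (F : cube m n -> R) : (\sum_x F x) * 2 = \sum_x (F x + F (s x)).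
  rewrite big_split /= mulr_natr mulr2n; congr (_ + _).
  by rewrite (reindex_inj (inv_inj (@coord_swapK m n i a b))).
rewrite -(ler_pM2r (ltr0n R 2)) !dbl; apply: ler_sum => x _.
rewrite /s /coord_swap; case: (eqVneq (x i) a) => [xa|xa]; first exact: Hab.
case: (eqVneq (x i) b) => [xb|xb]; last by apply: lerD; apply: Ho.
have := Hab (upd x i a); rewrite updE eqxx upd_upd (upd_id xb) => /(_ erefl).
by rewrite addrC [X in _ <= X]addrC.
Qed.

(* u and v are the amounts of a feature at the two ends of a comparator holding
   the values p and q, and u' and v' those after the comparison. *)
Definition contracts (p q : bool) (u v u' v' : nat) : bool :=
  match p, q with
  | true, false => (u' <= v) && (v' <= u)
  | false, true => (u' <= u) && (v' <= v)
  | false, false => [&& u' <= u, u' <= v & u' + v' <= u + v]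
  | true, true => [&& v' <= u, v' <= v & u' + v' <= u + v]
  end%N.

(** For fixed [p] and [q] the condition is a conjunction of linear inequalities, so it passes from
    the bits of single directions to their total. *)
Lemma contracts_sum (I : finType) (p q : bool) (u v u' v' : I -> nat) :
  (forall j, contracts p q (u j) (v j) (u' j) (v' j)) ->
  contracts p q (\sum_j u j) (\sum_j v j) (\sum_j u' j) (\sum_j v' j).
Proof.
rewrite /contracts; case: p; case: q => H; rewrite -?big_split /=.
- by apply/and3P; split; apply: leq_sum => j _; case/and3P: (H j).
- by apply/andP; split; apply: leq_sum => j _; case/andP: (H j).
- by apply/andP; split; apply: leq_sum => j _; case/andP: (H j).
- by apply/and3P; split; apply: leq_sum => j _; case/and3P: (H j).
Qed.

Lemma sqrt_majorize (R : realType) (u v u' v' : nat) :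
  (u' <= u)%N -> (u' <= v)%N -> (u' + v' <= u + v)%N ->
  Num.sqrt u'%:R + Num.sqrt v'%:R <= Num.sqrt u%:R + Num.sqrt v%:R :> R.
Proof.
move=> uu uv s.
rewrite -ler_sqr ?nnegrE ?addr_ge0 ?sqrtr_ge0 // !sqrrD !sqr_sqrtr ?ler0n //.
rewrite -!sqrtrM ?ler0n // -!natrM.
rewrite [u'%:R + _ + _]addrAC [u%:R + _ + _]addrAC -!natrD.
apply: lerD; first by rewrite ler_nat.
(* After squaring it remains that [u' * v' <= u * v]: the product is at most [u' * (u + v - u')],
   and [(u - u') * (v - u') >= 0]. *)
by apply: ler_wMn2r; rewrite ler_wsqrtr // ler_nat; nia.
Qed.

Lemma contracts_sqrt (R : realType) p q u v u' v' :
  contracts p q u v u' v' ->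
  Num.sqrt u'%:R + Num.sqrt v'%:R <= Num.sqrt u%:R + Num.sqrt v%:R :> R.
Proof.
have mono k l : (k <= l)%N -> Num.sqrt k%:R <= Num.sqrt l%:R :> R.
  by move=> kl; rewrite ler_wsqrtr // ler_nat.
rewrite /contracts; case: p; case: q.
- case/and3P=> h1 h2 h3; rewrite addrC.
  by apply: sqrt_majorize => //; rewrite addnC.
- by case/andP=> h1 h2; rewrite addrC; apply: lerD; apply: mono.
- by case/andP=> h1 h2; apply: lerD; apply: mono.
- by case/and3P=> h1 h2 h3; apply: sqrt_majorize.
Qed.

Lemma contracts_neq (p q r s : bool) :
  contracts p q (p != r) (q != s) ((p && q) != (r && s)) ((p || q) != (r || s)).
Proof. by case: p; case: q; case: r; case: s. Qed.

(** * Violations on a line under a comparator in another direction *)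

Definition line_viol (m : nat) (p : bool) (al : 'I_m -> bool) (t : 'I_m) :=
  [exists c : 'I_m, if p then (t < c)%N && ~~ al c else (c < t)%N && al c].

(** A one of a conjunction is a one of both lines, and a one of a disjunction comes from at least
    one of them. So a violated zero of the conjunction is violated on both lines, and one of the
    disjunction on at least one line; for ones the roles are exchanged. *)
Lemma contracts_line_viol (m : nat) (p q : bool) (al ga : 'I_m -> bool) t :
  contracts p q (line_viol p al t) (line_viol q ga t)
    (line_viol (p && q) (fun c => al c && ga c) t)
    (line_viol (p || q) (fun c => al c || ga c) t).
Proof.
have loA : line_viol false (fun c => al c && ga c) t ==> line_viol false al t.
  apply/implyP=> /existsP[c /and3P[tc h1 h2]].
  by apply/existsP; exists c; rewrite tc.
have loG : line_viol false (fun c => al c && ga c) t ==> line_viol false ga t.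
  apply/implyP=> /existsP[c /and3P[tc h1 h2]].
  by apply/existsP; exists c; rewrite tc.
have hiA : line_viol true (fun c => al c || ga c) t ==> line_viol true al t.
  apply/implyP=> /existsP[c /andP[tc]]; rewrite negb_or => /andP[h1 h2].
  by apply/existsP; exists c; rewrite tc.
have hiG : line_viol true (fun c => al c || ga c) t ==> line_viol true ga t.
  apply/implyP=> /existsP[c /andP[tc]]; rewrite negb_or => /andP[h1 h2].
  by apply/existsP; exists c; rewrite tc.
have lo : line_viol false (fun c => al c || ga c) t ==>
          line_viol false al t || line_viol false ga t.
  apply/implyP=> /existsP[c /andP[tc /orP[h|h]]]; apply/orP; [left|right];
  by apply/existsP; exists c; rewrite tc.
have hi : line_viol true (fun c => al c && ga c) t ==>
          line_viol true al t || line_viol true ga t.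
  apply/implyP=> /existsP[c /andP[tc]]; rewrite negb_and => /orP[h|h];
  apply/orP; [left|right]; by apply/existsP; exists c; rewrite tc.
case: p; case: q => /=; move: loA loG hiA hiG lo hi.
all: do ![case: (line_viol _ _ _) => //=].
Qed.

Definition viol (m n : nat) (j : 'I_n) (h : boolfun m n) (x : cube m n) : bool :=
  line_viol (h x) (fun c => h (upd x j c)) (x j).

Lemma line_viol_ext (m : nat) p (al ga : 'I_m -> bool) t :
  al =1 ga -> line_viol p al t = line_viol p ga t.
Proof. by move=> e; apply: eq_existsb => c; rewrite e. Qed.

(** As [i != j], the comparator acts on the whole [j]-lines through the two ends, turning them into
    their pointwise conjunction and disjunction. *)
Lemma contracts_viol (m n : nat) (i j : 'I_n) (a b : 'I_m) (h : boolfun m n) (x : cube m n) :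
  (a < b)%N -> i != j -> x i = a ->
  contracts (h x) (h (upd x i b)) (viol j h x) (viol j h (upd x i b))
    (viol j (comparator i a b h) x) (viol j (comparator i a b h) (upd x i b)).
Proof.
move=> ab ij xa; rewrite /viol !comparator_hi // comparator_lo //.
have e : upd x i b j = x j by rewrite updE eq_sym (negbTE ij).
have xc c : upd x j c i = a by rewrite updE (negbTE ij).
rewrite e.
have lo c : comparator i a b h (upd x j c) =
            h (upd x j c) && h (upd (upd x i b) j c).
  by rewrite comparator_lo // updC // eq_sym.
have hi c : comparator i a b h (upd (upd x i b) j c) =
            h (upd x j c) || h (upd (upd x i b) j c).
  by rewrite updC // comparator_hi.
rewrite (line_viol_ext _ _ lo) (line_viol_ext _ _ hi).
exact: contracts_line_viol.
Qed.

(** * Sorting one direction by a network of comparators *)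

Definition sort_row (m : nat) (a : 'I_m) : seq ('I_m * 'I_m) :=
  [seq (a, b) | b <- [seq b : 'I_m <- enum 'I_m | (a < b)%N]].

Definition sort_pairs (m : nat) : seq ('I_m * 'I_m) :=
  flatten [seq sort_row a | a <- enum 'I_m].

Definition run (m n : nat) (i : 'I_n) (h : boolfun m n)
    (s : seq ('I_m * 'I_m)) : boolfun m n :=
  foldl (fun h p => comparator i p.1 p.2 h) h s.

(* Selection sort as a network of comparators: unlike a direct definition of the
   sorted function, this allows all arguments to be made on pairs of points. *)
Definition sort_dir (m n : nat) (i : 'I_n) (h : boolfun m n) : boolfun m n :=
  run i h (sort_pairs m).

Lemma sort_row_lt (m : nat) (a : 'I_m) p :
  p \in sort_row a -> p.1 = a /\ (a < p.2)%N.
Proof. by case/mapP=> b; rewrite mem_filter => /andP[ab _] ->. Qed.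

(** [P] speaks of a family of functions, so that several functions can be followed through the same
    comparators at once. *)
Lemma sort_dir_ind (m n : nat) (I : Type) (i : 'I_n)
    (P : (I -> boolfun m n) -> Prop) (F : I -> boolfun m n) :
  (forall (a b : 'I_m) G, (a < b)%N -> P G ->
     P (fun k => comparator i a b (G k))) ->
  P F -> P (fun k => sort_dir i (F k)).
Proof.
move=> step; rewrite /sort_dir /run.
have : forall p, p \in sort_pairs m -> (p.1 < p.2)%N.
  by move=> p /flattenP[s /mapP[a _ ->]] /sort_row_lt[-> ].
elim: (sort_pairs m) F => [|p s IH] F ps PF //=.
apply: (IH (fun k => comparator i p.1 p.2 (F k))).
  by move=> q qs; apply: ps; rewrite inE qs orbT.
by apply: step => //; apply: ps; rewrite inE eqxx.
Qed.

Definition line_ordered (m n : nat) (i : 'I_n) (c d : 'I_m) (h : boolfun m n) :=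
  forall x, h (upd x i c) -> h (upd x i d).

Lemma comparator_upd (m n : nat) i (a b c : 'I_m) (h : boolfun m n) x :
  comparator i a b h (upd x i c) =
    if c == a then h (upd x i a) && h (upd x i b)
    else if c == b then h (upd x i a) || h (upd x i b) else h (upd x i c).
Proof.
by rewrite ffunE updE eqxx !upd_upd; case: eqP => [->|_] //; case: eqP => [->|].
Qed.

(** The comparator [(a, b)] creates the order between [a] and [b]; the other comparators of the row
    can only lower the value at [a] and do not touch the one at [b]. *)
Lemma run_row_ordered (m n : nat) (i : 'I_n) (a b : 'I_m) (h : boolfun m n)
    (s : seq ('I_m * 'I_m)) :
  (forall p, p \in s -> p.1 = a /\ (a < p.2)%N) ->
  (a < b)%N -> (a, b) \in s \/ line_ordered i a b h ->
  line_ordered i a b (run i h s).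
Proof.
move=> ps ab; elim: s h ps => [|p s IH] h ps /=; first by case.
have [p1 p2] := ps p (mem_head _ _).
move=> H; apply: IH; first by move=> q qs; apply: ps; rewrite inE qs orbT.
have [pb|pb] := eqVneq p.2 b.
  right=> x; rewrite p1 pb !comparator_upd !eqxx.
  by case: eqP => [e|_]; [rewrite e ltnn in ab | case/andP=> ->].
case: H => [|H].
  rewrite inE => /orP[/eqP e|]; last by left.
  by rewrite -e eqxx in pb.
right=> x; rewrite p1 !comparator_upd eqxx.
case: eqP => [e|_]; first by rewrite e ltnn in ab.
by rewrite eq_sym (negbTE pb); case/andP=> /H.
Qed.

(** Later rows leave position [c] alone, and if its value is one then all later values are ones,
    which comparators preserve. *)
Lemma run_later_ordered (m n : nat) (i : 'I_n) (c : 'I_m) (h : boolfun m n)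
    (s : seq ('I_m * 'I_m)) :
  (forall p, p \in s -> (c < p.1)%N /\ (p.1 < p.2)%N) ->
  (forall d : 'I_m, (c < d)%N -> line_ordered i c d h) ->
  forall d : 'I_m, (c < d)%N -> line_ordered i c d (run i h s).
Proof.
elim: s h => [|p s IH] h ps H //=.
have [p1 p2] := ps p (mem_head _ _); have p3 := ltn_trans p1 p2.
apply: IH; first by move=> q qs; apply: ps; rewrite inE qs orbT.
move=> d cd x; rewrite !comparator_upd -!(inj_eq val_inj) /=.
rewrite (ltn_eqF p1) (ltn_eqF p3) => hc.
by rewrite !(H _ _ x hc) // !if_same.
Qed.

Definition mono_dir (m n : nat) (i : 'I_n) (h : boolfun m n) :=
  forall (x : cube m n) (c : 'I_m), (x i <= c)%N -> h x -> h (upd x i c).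

(** The row of [c] orders [c] against every later position. Since [enum] is increasing, all rows
    after it start above [c] and keep this order. *)
Lemma mono_sort_dir (m n : nat) (i : 'I_n) (h : boolfun m n) :
  mono_dir i (sort_dir i h).
Proof.
suff H (c d : 'I_m) : (c < d)%N -> line_ordered i c d (sort_dir i h).
  move=> x c; rewrite leq_eqVlt => /orP[/eqP e|xc] hx.
    by rewrite upd_id //; apply: val_inj.
  by apply: H xc _ _; rewrite upd_id.
have : sorted (fun a b : 'I_m => a < b)%N (enum 'I_m).
  rewrite -(sorted_map (f := val) (e' := ltn)) // val_enum_ord.
  exact: iota_ltn_sorted.
have : c \in enum 'I_m by rewrite mem_enum.
rewrite /sort_dir /sort_pairs; elim: (enum 'I_m) h => [|a s IH] h //=.
rewrite inE path_sortedE; last by move=> ? ? ? /ltn_trans; apply.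
move=> cs /andP[/allP sa ss] cd; rewrite /run foldl_cat.
have [ca|ca] := eqVneq c a; last first.
  by apply: IH => //; move: cs; rewrite (negbTE ca).
move: cd; rewrite ca => ad; apply: (run_later_ordered (c := a)) => //.
  move=> p /flattenP[t /mapP[b bs ->]] /sort_row_lt[-> ?].
  by split=> //; apply: sa.
move=> b ab; apply: run_row_ordered => //; first exact: sort_row_lt.
by left; rewrite map_f // mem_filter ab mem_enum.
Qed.

(** Conjunctions and disjunctions of increasing lines are increasing; this is why directions once
    sorted stay sorted. *)
Lemma mono_comparator (m n : nat) (i j : 'I_n) (a b : 'I_m) (h : boolfun m n) :
  (a < b)%N -> i != j -> mono_dir j h -> mono_dir j (comparator i a b h).
Proof.
move=> ab ij H x c xc.
have e : upd x j c i = x i by rewrite updE (negbTE ij).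
have xd d : (upd x i d j <= c)%N by rewrite updE eq_sym (negbTE ij).
have ji : j != i by rewrite eq_sym.
rewrite !comparatorE e; case: eqP => [_|_].
  by case/andP=> h1 h2; rewrite H // updC // H.
case: eqP => [_|_]; last exact: H.
by case/orP=> h1; [rewrite updC // H | rewrite (H x) ?orbT].
Qed.

Lemma mono_sort_dir_other (m n : nat) (i j : 'I_n) (h : boolfun m n) :
  i != j -> mono_dir j h -> mono_dir j (sort_dir i h).
Proof.
move=> ij; apply: (sort_dir_ind (I := unit) (i := i)
  (P := fun F => mono_dir j (F tt)) (F := fun=> h)) => a b G ab.
exact: mono_comparator.
Qed.

Lemma sort_dir_mono (m n : nat) (i : 'I_n) (h : boolfun m n) :
  mono_dir i h -> sort_dir i h = h.
Proof.
move=> H; apply: (sort_dir_ind (I := unit) (i := i)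
  (P := fun F => F tt = h) (F := fun=> h)) => // a b G ab ->.
apply/ffunP=> x; rewrite ffunE; case: eqP => [xa|_].
  by case E: (h x) => //=; apply: H E; rewrite xa ltnW.
case: eqP => [xb|//]; rewrite orbC; case E: (h x) => //=.
apply/negP=> /(H _ b); rewrite updE eqxx upd_upd upd_id // E.
by move/(_ (ltnW ab)).
Qed.

(** * Hamming distance, and sorting along a list of directions *)

Definition hamming (R : realType) (m n : nat) (h k : boolfun m n) : R :=
  \sum_x (h x != k x)%:R.

Lemma hamming_le_comparator (R : realType) (m n : nat) (i : 'I_n) (a b : 'I_m)
    (h k : boolfun m n) :
  (a < b)%N ->
  hamming R (comparator i a b h) (comparator i a b k) <= hamming R h k.
Proof.
move=> ab; apply: (ler_sum_paired (i := i) (a := a) (b := b)) => x xa; last first.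
  by move=> xb; rewrite !comparator_other.
rewrite !comparator_hi // !comparator_lo //.
rewrite -!natrD ler_nat; case: (h x); case: (h (upd x i b)).
all: by case: (k x); case: (k _).
Qed.

Lemma hamming_sort_dir (R : realType) (m n : nat) (i : 'I_n) (h k : boolfun m n) :
  hamming R (sort_dir i h) (sort_dir i k) <= hamming R h k.
Proof.
apply: (sort_dir_ind (I := bool) (i := i)
  (P := fun F => hamming R (F true) (F false) <= hamming R h k)
  (F := fun b => if b then h else k)) => // a b G ab.
by apply: le_trans; apply: hamming_le_comparator.
Qed.

Lemma hammingC (R : realType) (m n : nat) (h k : boolfun m n) :
  hamming R h k = hamming R k h.
Proof. by apply: eq_bigr => x _; rewrite eq_sym. Qed.

Lemma hamming_triangle (R : realType) (m n : nat) (h k l : boolfun m n) :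
  hamming R h l <= hamming R h k + hamming R k l.
Proof.
rewrite -big_split; apply: ler_sum => x _ /=.
by rewrite -natrD ler_nat; case: (h x); case: (k x); case: (l x).
Qed.

Definition sort_dirs (m n : nat) (h : boolfun m n) (L : seq 'I_n) :=
  foldl (fun h i => sort_dir i h) h L.

Lemma hamming_sort_dirs (R : realType) (m n : nat) (h k : boolfun m n) L :
  hamming R (sort_dirs h L) (sort_dirs k L) <= hamming R h k.
Proof.
elim: L h k => [|i L IH] h k //=.
exact: le_trans (IH _ _) (hamming_sort_dir _ _ _ _).
Qed.

Lemma mono_sort_dirs (m n : nat) (h : boolfun m n) (L : seq 'I_n) i :
  i \in L -> mono_dir i (sort_dirs h L).
Proof.
elim/last_ind: L => [|L j IH] //; rewrite mem_rcons inE /sort_dirs foldl_rcons.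
have [->|ij] := eqVneq i j; first by move=> _; apply: mono_sort_dir.
by move/IH => H; apply: mono_sort_dir_other => //; rewrite eq_sym.
Qed.

Lemma sort_dirs_mono (m n : nat) (h : boolfun m n) (L : seq 'I_n) :
  (forall i, i \in L -> mono_dir i h) -> sort_dirs h L = h.
Proof.
elim: L => [|i L IH] //= H; rewrite sort_dir_mono ?IH //.
  by move=> j jL; apply: H; rewrite inE jL orbT.
by apply: H; rewrite inE eqxx.
Qed.

Lemma monotone_of_mono_dir (m n : nat) (h : boolfun m n) :
  (forall i, mono_dir i h) -> monotone h.
Proof.
move=> H; apply/forallP=> x; apply/forallP=> y; apply/implyP=> /forallP xy.
suff: h x -> h y by case: (h x) => // ->.
(* [z k] leads from [x] to [y], raising one coordinate at a time. *)
move=> hx; pose z k : cube m n := [ffun i : 'I_n => if (i < k)%N then y i else x i].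
have hz k : (k <= n)%N -> h (z k).
  elim: k => [_|k IH kn].
    by rewrite (_ : z 0%N = x) //; apply/ffunP=> i; rewrite ffunE.
  have -> : z k.+1 = upd (z k) (Ordinal kn) (y (Ordinal kn)).
    apply/ffunP=> i; rewrite updE !ffunE ltnS leq_eqVlt -(inj_eq val_inj) /=.
    by case: eqP => //= e; congr (y _); apply: val_inj.
  by apply: H (IH (ltnW kn)); rewrite ffunE ltnn.
by rewrite (_ : y = z n) ?hz //; apply/ffunP=> i; rewrite ffunE ltn_ord.
Qed.

(** * Square-root mass of the features while one direction is sorted *)

(* On each line in direction [i], the points outside [w] form an initial segment
   of zeros of [h] and a final segment of ones. *)
Definition settled (m n : nat) (i : 'I_n) (w : pred (cube m n))
    (h : boolfun m n) :=
  forall (y : cube m n) (c : 'I_m), ~~ w y ->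
    (if h y then (y i <= c)%N else (c <= y i)%N) ->
    ~~ w (upd y i c) /\ h (upd y i c) = h y.

(** Above an unviolated one there are only ones, and these are unviolated as well; dually below an
    unviolated zero. *)
Lemma settled_viol (m n : nat) (i : 'I_n) (h : boolfun m n) :
  settled i (viol i h) h.
Proof.
move=> y c ny; move: (ny); rewrite /viol /line_viol => /existsPn nv.
have val (d : 'I_m) : (if h y then (y i <= d)%N else (d <= y i)%N) -> h (upd y i d) = h y.
  have := nv d; case E: (h y); rewrite negb_and ?negbK -?leqNgt.
    case/orP=> // h1 h2; rewrite upd_id ?E //.
    by apply/val_inj/eqP; rewrite eqn_leq h2.
  case/orP=> [h1 h2|/negbTE//]; rewrite upd_id ?E //.
  by apply/val_inj/eqP; rewrite eqn_leq h1.
move=> yc; split; last exact: val.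
apply/existsPn=> d; rewrite (val _ yc) upd_upd updE eqxx.
move: yc (val d); case E: (h y) => yc H.
  by apply/negP=> /andP[cd]; rewrite H // (leq_trans yc (ltnW cd)).
by apply/negP=> /andP[cd]; rewrite H // (leq_trans (ltnW cd) yc).
Qed.

Lemma settled_comparator_eq (m n : nat) (i : 'I_n) w (a b : 'I_m)
    (h : boolfun m n) (y : cube m n) :
  (a < b)%N -> settled i w h -> ~~ w y -> comparator i a b h y = h y.
Proof.
move=> ab S wy; rewrite comparatorE; have H := S y _ wy.
case: eqP => [ya|_].
  by move: (H b); case: (h y) => //= /(_ _)[|_ ->] //; rewrite ya ltnW.
case: eqP => [yb|//].
by move: (H a); case: (h y) => /=; rewrite ?orbT // orbF yb => /(_ (ltnW ab))[_ ->].
Qed.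

Lemma settled_comparator (m n : nat) (i : 'I_n) w (a b : 'I_m)
    (h : boolfun m n) :
  (a < b)%N -> settled i w h -> settled i w (comparator i a b h).
Proof.
move=> ab S y c wy; rewrite (settled_comparator_eq ab S wy) => yc.
have [wc hc] := S y c wy yc; split=> //.
by rewrite (settled_comparator_eq ab S wc).
Qed.

(** The set [w] stays fixed and still behaves as a feature. If the values get swapped, both ends lie
    in [w]; if both are zeros, the lower end lies in [w] only if the upper one does; for two ones it
    is the reverse. *)
Lemma contracts_settled (m n : nat) (i : 'I_n) (w : pred (cube m n))
    (a b : 'I_m) (h : boolfun m n) (x : cube m n) :
  (a < b)%N -> settled i w h -> x i = a ->
  contracts (h x) (h (upd x i b)) (w x) (w (upd x i b)) (w x) (w (upd x i b)).
Proof.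
move=> ab S xa; have Sx := S x b; have := S (upd x i b) a.
rewrite upd_upd (upd_id xa) updE eqxx => Sy.
move: Sx Sy; rewrite xa; case: (h x); case: (h (upd x i b)) => /=.
all: case: (w x); case: (w (upd x i b)) => //= Sx Sy.
all: by [case: (Sx isT (ltnW ab)) | case: (Sy isT (ltnW ab))].
Qed.

(* The quantity attached to direction [j] when the directions in [D] have been
   treated and direction [i] is being sorted: [H j] is the function obtained by
   treating [j] the other way. *)
Definition feature (m n : nat) (i : 'I_n) (w : pred (cube m n)) (D : seq 'I_n)
    (h : boolfun m n) (H : 'I_n -> boolfun m n) (j : 'I_n) (x : cube m n) : bool :=
  if j == i then w x else if j \in D then h x != H j x else viol j h x.

Definition root_mass (R : realType) (m n : nat) (phi : 'I_n -> cube m n -> bool)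
    : R :=
  \sum_x Num.sqrt (\sum_j (phi j x : nat))%:R.

Lemma root_mass_le (R : realType) (m n : nat) (phi psi : 'I_n -> cube m n -> bool) :
  (forall j x, phi j x -> psi j x) -> root_mass R phi <= root_mass R psi.
Proof.
move=> H; apply: ler_sum => x _; rewrite ler_wsqrtr // ler_nat.
by apply: leq_sum => j _; have := H j x; case: (phi j x) => // ->.
Qed.

(** Each direction contracts for its own reason: [i] since [w] is settled, a treated direction since
    disagreement contracts, an untreated one by its violations. The total then contracts, and so do
    the square roots. *)
Lemma root_mass_comparator (R : realType) (m n : nat) (i : 'I_n) w D
    (a b : 'I_m) (h : boolfun m n) (H : 'I_n -> boolfun m n) :
  (a < b)%N -> settled i w h ->
  root_mass R (feature i w D (comparator i a b h)
                 (fun j => comparator i a b (H j)))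
    <= root_mass R (feature i w D h H).
Proof.
move=> ab S; apply: (ler_sum_paired (i := i) (a := a) (b := b)) => x xa.
  apply: (contracts_sqrt R (p := h x) (q := h (upd x i b))).
  apply: contracts_sum => j; rewrite /feature.
  case: (eqVneq j i) => [_|ji]; first exact: (contracts_settled ab S xa).
  case: ifP => _; last by apply: contracts_viol; rewrite // eq_sym.
  by rewrite !comparator_hi // !comparator_lo //; apply: contracts_neq.
move=> xb; rewrite ler_wsqrtr // ler_nat; apply: leq_sum => j _.
rewrite /feature; case: (eqVneq j i) => [_|ji] //.
case: ifP => _; first by rewrite !comparator_other.
rewrite /viol /line_viol comparator_other //.
have e c : comparator i a b h (upd x j c) = h (upd x j c).
  by rewrite comparator_other // updE [i == j]eq_sym (negbTE ji).
by under eq_existsb => c do rewrite e.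
Qed.

Lemma root_mass_sort_dir (R : realType) (m n : nat) (i : 'I_n) w D
    (h : boolfun m n) (H : 'I_n -> boolfun m n) :
  settled i w h ->
  (forall y, ~~ w y -> sort_dir i h y = h y) /\
  root_mass R (feature i w D (sort_dir i h) (fun j => sort_dir i (H j)))
    <= root_mass R (feature i w D h H).
Proof.
(* [h] and all the [H j] are packed into one family for [sort_dir_ind]. *)
move=> S; pose Fm (k : option 'I_n) := if k is Some j then H j else h.
suff: [/\ settled i w (sort_dir i (Fm None)),
         forall y, ~~ w y -> sort_dir i (Fm None) y = h y &
         root_mass R (feature i w D (sort_dir i (Fm None))
            (fun j => sort_dir i (Fm (Some j))))
         <= root_mass R (feature i w D h H)] by case.
apply: (sort_dir_ind (i := i) (F := Fm) (P := fun G =>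
  [/\ settled i w (G None), forall y, ~~ w y -> G None y = h y &
    root_mass R (feature i w D (G None) (fun j => G (Some j)))
      <= root_mass R (feature i w D h H)])) => // a b G ab [S1 S2 S3].
split; first exact: settled_comparator.
  by move=> y wy; rewrite (settled_comparator_eq ab S1 wy) S2.
by apply: le_trans S3; apply: root_mass_comparator.
Qed.

(** * Sensitivity to the choice of the sorted directions *)

Definition toggle (n : nat) (b : pred 'I_n) (i : 'I_n) : pred 'I_n :=
  fun j => b j (+) (j == i).

Lemma filter_toggle (n : nat) (b : pred 'I_n) (i : 'I_n) Q :
  i \notin Q -> filter (toggle b i) Q = filter b Q.
Proof.
move=> iQ; apply: eq_in_filter => j jQ; rewrite /toggle.
by case: eqP => [e|_]; rewrite ?addbF //; rewrite -e jQ in iQ.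
Qed.

(** Interpolates between the violations of [f], for empty [Q], and the sensitivity of the value at
    [x] to the selection [b], when [Q] contains all directions. *)
Definition tracker_feature (m n : nat) (f : boolfun m n) (b : pred 'I_n)
    (Q : seq 'I_n) (j : 'I_n) (x : cube m n) : bool :=
  if j \in Q then
    sort_dirs f (filter b Q) x != sort_dirs f (filter (toggle b j) Q) x
  else viol j (sort_dirs f (filter b Q)) x.

(** The new feature at [i] compares [h] with [sort_dir i h], which differ only where [viol i h]
    holds. If [b i] is true, all functions get sorted along [i] and [root_mass_sort_dir] applies;
    otherwise [h] stays and the features compare pointwise. *)
Lemma tracker_feature_rcons (R : realType) (m n : nat) (f : boolfun m n)
    (b : pred 'I_n) (Q : seq 'I_n) (i : 'I_n) :
  i \notin Q ->
  root_mass R (tracker_feature f b (rcons Q i))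
    <= root_mass R (tracker_feature f b Q).
Proof.
move=> iQ; pose h := sort_dirs f (filter b Q).
pose H j := sort_dirs f (filter (toggle b j) Q).
have S := @settled_viol m n i h.
have [fix_ le_] := root_mass_sort_dir R Q H S.
have e0 : root_mass R (tracker_feature f b Q) =
          root_mass R (feature i (viol i h) Q h H).
  apply: eq_bigr => x _; congr (Num.sqrt _%:R); apply: eq_bigr => j _.
  rewrite /tracker_feature /feature.
  by case: (eqVneq j i) => [->|//]; rewrite (negbTE iQ).
rewrite e0; have sw x : sort_dir i h x != h x -> viol i h x.
  by apply: contraNT => /fix_ ->.
have tj j : j != i -> toggle b j i = b i.
  by rewrite /toggle eq_sym => /negbTE ->; rewrite addbF.
case bi: (b i).
  apply: le_trans le_; apply: root_mass_le => j x.
  rewrite /tracker_feature /feature mem_rcons inE !filter_rcons bi.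
  rewrite /sort_dirs foldl_rcons -/(sort_dirs _ _) -/h.
  case: (eqVneq j i) => [->|ji] /=; last by rewrite tj // bi foldl_rcons.
  rewrite /toggle eqxx bi /= -/(toggle b i) filter_toggle //; exact: sw.
apply: root_mass_le => j x.
rewrite /tracker_feature /feature mem_rcons inE !filter_rcons bi.
case: (eqVneq j i) => [->|ji] /=; last by rewrite tj // bi.
rewrite /toggle eqxx bi /= -/(toggle b i) filter_toggle //.
by rewrite /sort_dirs foldl_rcons eq_sym; apply: sw.
Qed.

Lemma tracker_sensitivity_le (R : realType) (m n : nat) (f : boolfun m n)
    (b : pred 'I_n) (Q : seq 'I_n) :
  uniq Q ->
  root_mass R (fun j x => sort_dirs f (filter b Q) x
                 != sort_dirs f (filter (toggle b j) Q) x)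
    <= root_mass R (fun j x => viol j f x).
Proof.
move=> uQ; apply: (@le_trans _ _ (root_mass R (tracker_feature f b Q))).
  apply: root_mass_le => j x; rewrite /tracker_feature; case: ifP => // /negbT jQ.
  by rewrite filter_toggle // eqxx.
elim/last_ind: Q uQ => [_|Q i IH]; first exact: root_mass_le.
rewrite rcons_uniq => /andP[iQ uQ].
exact: le_trans (tracker_feature_rcons _ _ _ iQ) (IH uQ).
Qed.

(** * Uniform averages over bit strings of length [n] *)

Fixpoint avg (R : realType) (n : nat) (F : bitseq -> R) : R :=
  if n is n'.+1 then
    (avg n' (fun b => F (false :: b)) + avg n' (fun b => F (true :: b))) / 2
  else F [::].

Lemma avg_le (R : realType) (n : nat) (F G : bitseq -> R) :
  (forall b, size b = n -> F b <= G b) -> avg n F <= avg n G.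
Proof.
elim: n F G => [|n IH] F G H /=; first exact: H.
rewrite ler_pM2r ?invr_gt0 ?ltr0n //.
by apply: lerD; apply: IH => b bn; apply: H; rewrite /= bn.
Qed.

Lemma eq_avg (R : realType) (n : nat) (F G : bitseq -> R) :
  (forall b, size b = n -> F b = G b) -> avg n F = avg n G.
Proof. by move=> H; apply/le_anti/andP; split; apply: avg_le => b /H ->. Qed.

Lemma avg_lin (R : realType) (n : nat) (c d : R) (F G : bitseq -> R) :
  avg n (fun b => c * F b + d * G b) = c * avg n F + d * avg n G.
Proof. by elim: n F G => [|n IH] F G //=; rewrite !IH; field. Qed.

Lemma avg_const (R : realType) (n : nat) (c : R) : avg n (fun=> c) = c.
Proof. by elim: n => [|n IH] //=; rewrite IH; field. Qed.

Lemma avgZ (R : realType) (n : nat) (c : R) (F : bitseq -> R) :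
  avg n (fun b => c * F b) = c * avg n F.
Proof.
rewrite -[RHS]addr0 -[X in _ + X](mul0r (avg n F)) -avg_lin.
by apply: eq_avg => b _; rewrite mul0r addr0.
Qed.

Lemma avgD (R : realType) (n : nat) (F G : bitseq -> R) :
  avg n (fun b => F b + G b) = avg n F + avg n G.
Proof.
rewrite -[avg n F]mul1r -[avg n G]mul1r -avg_lin.
by apply: eq_avg => b _; rewrite !mul1r.
Qed.

Lemma avg_sum (R : realType) (n : nat) (T : Type) (r : seq T)
    (F : T -> bitseq -> R) :
  avg n (fun b => \sum_(x <- r) F x b) = \sum_(x <- r) avg n (F x).
Proof.
elim: r => [|x r IH].
  by rewrite big_nil -[RHS](avg_const n); apply: eq_avg => b _; rewrite big_nil.
by rewrite big_cons -IH -avgD; apply: eq_avg => b _; rewrite big_cons.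
Qed.

Lemma avg_negb (R : realType) (n : nat) (F : bitseq -> R) :
  avg n (fun b => F (map negb b)) = avg n F.
Proof.
elim: n F => [|n IH] F //=.
rewrite (IH (fun b => F (true :: b))) (IH (fun b => F (false :: b))).
by rewrite addrC.
Qed.

Lemma avg_nth (R : realType) (n i : nat) :
  (i < n)%N -> avg n (fun b => (nth false b i)%:R) = 2^-1 :> R.
Proof.
elim: n i => [|n IH] [|i] //= lt; first by rewrite !avg_const; field.
by rewrite !IH //; field.
Qed.

(** A Fubini rule; [E] will be another average, and compatibility with midpoints is what the
    recursion of [avg] asks of it. *)
Lemma avg_exchange (R : realType) (T : Type) (E : (T -> R) -> R) (n : nat)
    (F : bitseq -> T -> R) :
  (forall G H, E (fun t => (G t + H t) / 2) = (E G + E H) / 2) ->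
  avg n (fun b => E (F b)) = E (fun t => avg n (fun b => F b t)).
Proof.
move=> hE; elim: n F => [|n IH] F //=.
by rewrite (IH (fun b => F (false :: b))) (IH (fun b => F (true :: b))) -hE.
Qed.

(** * The undirected Talagrand inequality on bit strings *)

Lemma le_sqrt (R : realType) (x y : R) : x ^+ 2 <= y -> x <= Num.sqrt y.
Proof.
move=> xy; apply: le_trans (ler_norm x) _.
by rewrite -sqrtr_sqr ler_wsqrtr.
Qed.

Lemma minkowski2 (R : realType) (x1 y1 x2 y2 : R) :
  Num.sqrt ((x1 + x2) ^+ 2 + (y1 + y2) ^+ 2)
    <= Num.sqrt (x1 ^+ 2 + y1 ^+ 2) + Num.sqrt (x2 ^+ 2 + y2 ^+ 2).
Proof.
have nn (x y : R) : 0 <= x ^+ 2 + y ^+ 2 by rewrite addr_ge0 ?sqr_ge0.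
rewrite -ler_sqr ?nnegrE ?addr_ge0 ?sqrtr_ge0 // [leRHS]sqrrD !sqr_sqrtr //.
have : x1 * x2 + y1 * y2
    <= Num.sqrt (x1 ^+ 2 + y1 ^+ 2) * Num.sqrt (x2 ^+ 2 + y2 ^+ 2).
  rewrite -sqrtrM //; apply: le_sqrt.
  (* Cauchy-Schwarz from Lagrange's identity: the two sides differ by this square. *)
  have := sqr_ge0 (x1 * y2 - x2 * y1); nra.
set S := Num.sqrt _ * Num.sqrt _ => h.
have -> : (x1 + x2) ^+ 2 + (y1 + y2) ^+ 2
    = x1 ^+ 2 + y1 ^+ 2 + (x1 * x2 + y1 * y2) *+ 2 + (x2 ^+ 2 + y2 ^+ 2) by ring.
by rewrite lerD2r lerD2l ler_wMn2r.
Qed.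

(** Jensen's inequality for the Euclidean norm of the plane. *)
Lemma avg_minkowski (R : realType) (n : nat) (u v : bitseq -> R) :
  Num.sqrt (avg n u ^+ 2 + avg n v ^+ 2)
    <= avg n (fun b => Num.sqrt (u b ^+ 2 + v b ^+ 2)).
Proof.
elim: n u v => [|n IH] u v //=.
have half (x y : R) :
    Num.sqrt ((x / 2) ^+ 2 + (y / 2) ^+ 2) = Num.sqrt (x ^+ 2 + y ^+ 2) / 2.
  rewrite -[2^-1 in RHS]ger0_norm ?invr_ge0 ?ler0n // -sqrtr_sqr -sqrtrM.
    by congr Num.sqrt; field.
  by rewrite addr_ge0 ?sqr_ge0.
rewrite [(avg n _ + _) / 2]mulrDl [(avg n (fun b => v _) + _) / 2]mulrDl.
apply: le_trans (minkowski2 _ _ _ _) _; rewrite !half -mulrDl.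
rewrite ler_pM2r ?invr_gt0 ?ltr0n //; apply: lerD.
  exact: (IH (fun b => u (false :: b)) (fun b => v (false :: b))).
exact: (IH (fun b => u (true :: b)) (fun b => v (true :: b))).
Qed.

Fixpoint flip_bit (b : bitseq) (i : nat) : bitseq :=
  match b, i with
  | [::], _ => [::]
  | c :: b', 0 => ~~ c :: b'
  | c :: b', i'.+1 => c :: flip_bit b' i'
  end.

Lemma nth_flip_bit (b : bitseq) (i j : nat) :
  (i < size b)%N -> nth false (flip_bit b i) j = nth false b j (+) (j == i).
Proof.
elim: b i j => [|c b IH] [|i] [|j] //= lt; rewrite ?addbT ?addbF //.
exact: IH.
Qed.

Definition sensitivity (n : nat) (g : bitseq -> bool) (b : bitseq) : nat :=
  \sum_(i < n) (g b != g (flip_bit b i)).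

Lemma two_point (R : realType) (a b : R) :
  0 <= a <= 1 -> 0 <= b <= 1 ->
  2 * ((a + b) / 2) * (1 - (a + b) / 2)
    <= (Num.sqrt ((2 * a * (1 - a)) ^+ 2 + (a - b) ^+ 2)
        + Num.sqrt ((2 * b * (1 - b)) ^+ 2 + (a - b) ^+ 2)) / 2.
Proof.
move=> a01 b01; rewrite ler_pdivlMr ?ltr0n //.
apply: le_trans (minkowski2 _ _ _ _); apply: le_sqrt.
set J := (a + b) / 2 * (1 - (a + b) / 2); set D := a - b.
have -> : 2 * a * (1 - a) + 2 * b * (1 - b) = 4 * J - D ^+ 2.
  by rewrite /J /D; field.
have -> : 2 * ((a + b) / 2) * (1 - (a + b) / 2) * 2 = 4 * J.
  by rewrite /J; field.
have J4 : J <= 1 / 4 by rewrite /J; have := sqr_ge0 (a + b - 1); nra.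
have D2 : 0 <= D ^+ 2 by rewrite sqr_ge0.
(* With [4 * J - D ^+ 2] and [2 * D] as coordinates, the claim is
   [8 * J * D ^+ 2 <= 4 * D ^+ 2 + D ^+ 4], which follows from [J <= 1 / 4]. *)
nra.
Qed.

Lemma avg_bool01 (R : realType) (n : nat) (g : bitseq -> bool) :
  0 <= avg n (fun b => (g b)%:R : R) <= 1.
Proof.
apply/andP; split.
  by rewrite -[X in X <= _](avg_const n); apply: avg_le => b _; rewrite ler0n.
by rewrite -[X in _ <= X](avg_const n); apply: avg_le => b _; case: (g b).
Qed.

(** Induction on the first bit. The sensitivity is that of the half [gc c] plus the bit [d b], so
    its root is the norm of a plane vector. By [avg_minkowski] the mean norm is at least the norm of
    the mean, whose coordinates are bounded below by the induction hypothesis and by the difference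
    of the two means; [two_point] combines the halves. *)
Lemma talagrand (R : realType) (n : nat) (g : bitseq -> bool) :
  2 * avg n (fun b => (g b)%:R) * (1 - avg n (fun b => (g b)%:R))
    <= avg n (fun b => Num.sqrt (sensitivity n g b)%:R) :> R.
Proof.
elim: n g => [|n IH] g.
  by rewrite /=; case: (g _); rewrite ?subrr ?mulr0 ?mul0r sqrtr_ge0.
pose gc c b := g (c :: b).
pose a c : R := avg n (fun b => (gc c b)%:R).
pose d b := gc false b != gc true b.
have sE c b : (sensitivity n.+1 g (c :: b)) = (d b + sensitivity n (gc c) b)%N.
  rewrite /sensitivity big_ord_recl /=; congr (_ + _)%N.
  by rewrite /d /gc; case: c; rewrite //= eq_sym.
have step c : Num.sqrt ((2 * a c * (1 - a c)) ^+ 2 + (a false - a true) ^+ 2)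
    <= avg n (fun b => Num.sqrt (sensitivity n.+1 g (c :: b))%:R).
  apply: (@le_trans _ _ (avg n (fun b =>
    Num.sqrt (Num.sqrt (sensitivity n (gc c) b)%:R ^+ 2 + (d b)%:R ^+ 2)))); last first.
    apply: avg_le => b _; rewrite sE natrD addrC sqr_sqrtr ?ler0n //.
    by case: (d b); rewrite ?expr1n ?expr0n.
  apply: le_trans (avg_minkowski _ _ _); rewrite ler_wsqrtr //.
  have /andP[a0 a1] := avg_bool01 R n (gc c).
  have dist : `|a false - a true| <= avg n (fun b => (d b)%:R).
    rewrite ler_norml -mulN1r; apply/andP; split.
      rewrite -avgZ lerBrDr -avgD; apply: avg_le => b _.
      by rewrite /d; case: (gc false b); case: (gc true b) => /=; lra.
    rewrite lerBlDr -avgD; apply: avg_le => b _.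
    by rewrite /d; case: (gc false b); case: (gc true b) => /=; lra.
  apply: lerD; last first.
    rewrite -[(a false - _) ^+ 2]real_normK ?num_real //.
    by rewrite lerXn2r ?nnegrE // (le_trans _ dist).
  rewrite lerXn2r ?nnegrE //; last exact: IH.
    by rewrite !mulr_ge0 // subr_ge0.
  apply: le_trans (IH _); by rewrite !mulr_ge0 // subr_ge0.
have := two_point (avg_bool01 R n (gc false)) (avg_bool01 R n (gc true)).
move/le_trans; apply=> /=.
rewrite ler_pM2r ?invr_gt0 ?ltr0n //.
exact: lerD (step false) (step true).
Qed.

Lemma avg_antipodal (R : realType) (n : nat) (g : bitseq -> bool) :
  avg n (fun b => (g b != g (map negb b))%:R)
    <= 2 * avg n (fun b => Num.sqrt (sensitivity n g b)%:R) :> R.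
Proof.
have T := talagrand R n g; have /andP[a0 a1] := avg_bool01 R n g.
set a := avg n (fun b => (g b)%:R) in T a0 a1.
have aN : avg n (fun b => (g (map negb b))%:R) = a.
  exact: (avg_negb n (fun b => (g b)%:R)).
have up1 : avg n (fun b => (g b != g (map negb b))%:R) <= 2 * a.
  have -> : 2 * a = a + a by ring.
  rewrite -{2}aN -avgD; apply: avg_le => b _.
  by case: (g b); case: (g _) => /=; lra.
have up2 : avg n (fun b => (g b != g (map negb b))%:R) <= 2 * (1 - a).
  have -> : 2 * (1 - a) = 2 + (-1) * (a + a) by ring.
  rewrite -{2}aN -avgD -avgZ -[X in X + _](avg_const n) -avgD.
  apply: avg_le => b _; by case: (g b); case: (g _) => /=; lra.
(* The larger of [a] and [1 - a] is at least one half, so twice the smaller is at most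
   [4 * a * (1 - a)]. *)
nra.
Qed.

(** * Sorting along a random set of directions and along its complement *)

Definition selected (n : nat) (b : bitseq) : pred 'I_n := fun i => nth false b i.

Definition neg_root (R : realType) (m n : nat) (f : boolfun m n) : R :=
  root_mass R (fun j x => viol j f x).

Lemma avg_hamming_antipodal (R : realType) (m n : nat) (f : boolfun m n)
    (Q : seq 'I_n) :
  uniq Q ->
  avg n (fun b => hamming R (sort_dirs f (filter (selected b) Q))
                    (sort_dirs f (filter (selected (map negb b)) Q)))
    <= 2 * neg_root R f.
Proof.
move=> uQ; pose g (x : cube m n) b := sort_dirs f (filter (selected b) Q) x.
rewrite /hamming avg_sum.
apply: (@le_trans _ _ (\sum_x 2 * avg n (fun b =>
    Num.sqrt (sensitivity n (g x) b)%:R))).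
  by apply: ler_sum => x _; apply: (avg_antipodal R n (g x)).
rewrite -mulr_sumr ler_pM2l ?ltr0n // -avg_sum -[leRHS](avg_const n).
(* The bound by sensitivity was taken for fixed [x]; now [b] is fixed and the sum over [x] is
   estimated. *)
apply: avg_le => b bn; apply: le_trans (tracker_sensitivity_le R f (selected b) uQ).
apply: ler_sum => x _; rewrite ler_wsqrtr // ler_nat; apply: leq_sum => j _.
suff e : selected (flip_bit b j) =1 toggle (selected b) j.
  by rewrite /g (eq_filter e).
by move=> i; rewrite /selected /toggle nth_flip_bit ?bn.
Qed.

(* Sorting along the unselected directions is a contraction that fixes the
   function already sorted along them. *)
Lemma avg_hamming_complement (R : realType) (m n : nat) (f : boolfun m n)
    (Q : seq 'I_n) :
  uniq Q ->
  avg n (fun b => hamming R (sort_dirs f (filter (selected b) Q))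
    (sort_dirs (sort_dirs f (filter (selected b) Q))
       (filter (predC (selected b)) Q)))
    <= 4 * neg_root R f.
Proof.
move=> uQ; have -> : 4 * neg_root R f = 2 * (2 * neg_root R f) by ring.
apply: le_trans (_ : _ <= 2 * avg n _) _; last first.
  rewrite ler_pM2l ?ltr0n //; exact: (avg_hamming_antipodal R f uQ).
rewrite -avgZ; apply: avg_le => b bn.
have -> : filter (predC (selected b)) Q = filter (selected (map negb b)) Q.
  apply: eq_filter => i; rewrite /selected /= (nth_map false) // bn.
  exact: ltn_ord.
set h := sort_dirs f _; set Q' := filter (selected (map negb b)) Q.
set k := sort_dirs f Q'.
have kk : sort_dirs k Q' = k.
  by apply: sort_dirs_mono => i iQ; apply: mono_sort_dirs.
apply: le_trans (hamming_triangle R h k _) _.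
have := hamming_sort_dirs R k h Q'; rewrite kk [in hamming R k h]hammingC; lra.
Qed.

(** * Random orders of the directions by repeated halving *)

(** Orders directions lexicographically by the bits they receive from [B], ones first, with ties as
    in [L]. Both halves use the same [B'], so that shuffling commutes with filtering. *)
Fixpoint shuffle (n : nat) (B : seq bitseq) (L : seq 'I_n) : seq 'I_n :=
  if B is b :: B' then
    shuffle B' (filter (selected b) L)
      ++ shuffle B' (filter (predC (selected b)) L)
  else L.

Lemma shuffle_filter (n : nat) (B : seq bitseq) (p : pred 'I_n) L :
  shuffle B (filter p L) = filter p (shuffle B L).
Proof.
elim: B p L => [|b B IH] p L //=.
rewrite filter_cat -!IH; congr (shuffle _ _ ++ shuffle _ _);
by rewrite -!filter_predI; apply: eq_filter => i /=; rewrite andbC.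
Qed.

Lemma perm_shuffle (n : nat) (B : seq bitseq) (L : seq 'I_n) :
  perm_eq (shuffle B L) L.
Proof.
elim: B L => [|b B IH] L //=.
by rewrite !shuffle_filter; apply: perm_trans (IH L); rewrite perm_filterC.
Qed.

Fixpoint avgs (R : realType) (n k : nat) (F : seq bitseq -> R) : R :=
  if k is k'.+1 then avg n (fun b => avgs n k' (fun B => F (b :: B)))
  else F [::].

Lemma avgs_le (R : realType) (n k : nat) (F G : seq bitseq -> R) :
  (forall B, F B <= G B) -> avgs n k F <= avgs n k G.
Proof.
elim: k F G => [|k IH] F G H /=; first exact: H.
by apply: avg_le => b _; apply: IH.
Qed.

Lemma avgs_lin (R : realType) (n k : nat) (c d : R) (F G : seq bitseq -> R) :
  avgs n k (fun B => c * F B + d * G B) = c * avgs n k F + d * avgs n k G.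
Proof.
elim: k F G => [|k IH] F G //=; rewrite -avg_lin.
by apply: eq_avg => b _; rewrite -IH.
Qed.

Lemma avgs_const (R : realType) (n k : nat) (c : R) : avgs n k (fun=> c) = c.
Proof.
elim: k => [|k IH] //=; rewrite -[RHS](avg_const n).
by apply: eq_avg => b _; rewrite IH.
Qed.

Lemma eq_avgs (R : realType) (n k : nat) (F G : seq bitseq -> R) :
  (forall B, F B = G B) -> avgs n k F = avgs n k G.
Proof. by move=> H; apply/le_anti/andP; split; apply: avgs_le => B; rewrite H. Qed.

Lemma hamming_le_card (R : realType) (m n : nat) (f g : boolfun m n) :
  hamming R f g <= #|cube m n|%:R.
Proof.
rewrite /hamming -sum1_card natr_sum; apply: ler_sum => x _.
by rewrite ler_nat; case: (_ != _).
Qed.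

Lemma avg_size_selected (R : realType) (n : nat) (L : seq 'I_n) :
  avg n (fun b => (size (filter (selected b) L))%:R) = (size L)%:R / 2 :> R.
Proof.
elim: L => [|i L IH] /=; first by rewrite avg_const mul0r.
rewrite -addn1 natrD mulrDl -IH addrC -[1 / 2]/(1 * 2^-1) mul1r.
rewrite -(avg_nth R (ltn_ord i)) -avgD; apply: eq_avg => b _.
by rewrite /selected; case: (nth _ _ _); rewrite /= ?add0r // -natrD.
Qed.

(** Induction on [k], with a triangle through [f] sorted along the half selected by the first
    string. The way to it is the induction hypothesis for a list half as long on average; the rest
    costs [4 * neg_root R f] by [avg_hamming_complement]. *)
Lemma avgs_hamming_shuffle (R : realType) (m n k : nat) (f : boolfun m n)
    (L : seq 'I_n) :
  uniq L ->
  avgs n k (fun B => hamming R f (sort_dirs f (shuffle B L)))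
    <= 4 * k%:R * neg_root R f + #|cube m n|%:R * (size L)%:R / 2 ^+ k.
Proof.
elim: k L => [|k IH] L uL.
  rewrite /= mulr0 mul0r add0r expr0 divr1; case: L {uL} => [|i L].
    rewrite /hamming big1 ?mulr0 // => x _; by rewrite eqxx.
  apply: le_trans (hamming_le_card _ _ _) _.
  by rewrite ler_peMr ?ler0n // ler1n.
set N : R := #|_|%:R; set Psi := neg_root R f.
pose Y b B := hamming R f (sort_dirs f (shuffle B (filter (selected b) L))).
pose X b B := hamming R (sort_dirs f (filter (selected b) (shuffle B L)))
  (sort_dirs (sort_dirs f (filter (selected b) (shuffle B L)))
     (filter (predC (selected b)) (shuffle B L))).
apply: (@le_trans _ _ (avg n (fun b => avgs n k (Y b)) +
                       avg n (fun b => avgs n k (X b)))).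
  rewrite /= -avgD; apply: avg_le => b _.
  rewrite -[avgs n k (Y b)]mul1r -[avgs n k (X b)]mul1r -avgs_lin.
  apply: avgs_le => B; rewrite !mul1r /Y /X /sort_dirs foldl_cat.
  by rewrite -!/(sort_dirs _ _) !shuffle_filter; apply: hamming_triangle.
have hX : avg n (fun b => avgs n k (X b)) <= 4 * Psi.
  (* The average over [b] is taken first: [avg_hamming_complement] needs the list [shuffle B L] to
     be fixed. *)
  rewrite avg_exchange; last first.
    move=> G H; rewrite mulrDl mulrC [avgs n k H / 2]mulrC -avgs_lin.
    by apply: eq_avgs => B; field.
  rewrite -[leRHS](avgs_const n k); apply: avgs_le => B.
  by apply: avg_hamming_complement; rewrite (perm_uniq (perm_shuffle B L)).
have hY : avg n (fun b => avgs n k (Y b))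
    <= 4 * k%:R * Psi + N / 2 ^+ k * ((size L)%:R / 2).
  rewrite -avg_size_selected -avgZ -[X in X + _](avg_const n) -avgD.
  apply: avg_le => b _; apply: le_trans (IH _ (filter_uniq _ uL)) _.
  by rewrite -/N -/Psi [N / _ * _]mulrAC.
apply: le_trans (lerD hY hX) _; rewrite -natr1 exprS.
rewrite le_eqVlt; apply/orP; left; apply/eqP; field.
by rewrite expf_neq0 // pnatr_eq0.
Qed.

(** * From sums over the cube to expectations and the distance to monotonicity *)

Lemma viol_le_neg_sensitivity (m n : nat) (f : boolfun m n) (x : cube m n) :
  (\sum_j (viol j f x : nat) <= neg_sensitivity f x)%N.
Proof.
rewrite /neg_sensitivity -sum1_card big_mkcond /=.
rewrite [leqRHS]big_mkcond; apply: leq_sum => j _; rewrite inE.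
case V: (viol j f x) => //; rewrite ifT //.
move: V; rewrite /viol /line_viol => /existsP[c V].
apply/existsP; exists (upd x j c).
apply/andP; split.
  by apply/forallP=> k; apply/implyP=> kj; rewrite updE (negbTE kj).
have ne : x j != c -> x != upd x j c.
  by apply: contra => /eqP ->; rewrite updE eqxx.
have upP : (x j <= c)%N -> cube_le x (upd x j c).
  by move=> xc; apply/forallP=> k; rewrite updE; case: eqP => [->|].
have dnP : (c <= x j)%N -> cube_le (upd x j c) x.
  by move=> xc; apply/forallP=> k; rewrite updE; case: eqP => [->|].
rewrite /violates /cube_lt; move: V; case: (f x) => /andP[xc].
  have xne : x j != c by rewrite -val_eqE /= ltn_eqF.
  by move/negbTE=> ->; rewrite (ne xne) (upP (ltnW xc)).
have xne : x j != c by rewrite -val_eqE /= gtn_eqF.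
by move=> ->; rewrite [upd x j c == x]eq_sym (ne xne) (dnP (ltnW xc)) orbT.
Qed.

Lemma prod_mass_uniform (R : realType) (m n : nat) (x : cube m n) :
  prod_mass (@uniform R m) x = #|cube m n|%:R^-1.
Proof.
rewrite /prod_mass /uniform prodr_const card_ffun !card_ord.
by rewrite natrX exprVn.
Qed.

Lemma neg_root_le_expect (R : realType) (m n : nat) (f : boolfun m n) :
  neg_root R f / #|cube m n|%:R
    <= expect (prod_mass (@uniform R m))
         (fun x => Num.sqrt (neg_sensitivity f x)%:R).
Proof.
rewrite /neg_root /root_mass mulr_suml; apply: ler_sum => x _.
rewrite prod_mass_uniform mulrC ler_wpM2l ?invr_ge0 ?ler0n //.
by rewrite ler_wsqrtr // ler_nat viol_le_neg_sensitivity.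
Qed.

Lemma neg_root_ge0 (R : realType) (m n : nat) (f : boolfun m n) :
  0 <= neg_root R f / #|cube m n|%:R.
Proof. by rewrite divr_ge0 ?ler0n ?sumr_ge0 // => x _; rewrite sqrtr_ge0. Qed.

Lemma far_le_hamming (R : realType) (m n : nat) (eps : R) (f g : boolfun m n) :
  far_from_monotone (prod_mass (@uniform R m)) eps f -> monotone g ->
  eps <= hamming R f g / #|cube m n|%:R.
Proof.
move=> far mg; apply: le_trans far _; apply: le_trans (dist_monotone_le _ _ mg) _.
rewrite /disagreement /meas /hamming mulr_suml big_mkcond /=.
apply: ler_sum => x _; rewrite inE prod_mass_uniform.
by case: (_ != _); rewrite ?mul1r ?mul0r.
Qed.

(** For every [B] the shuffled list contains all directions, so the sorted function is monotone and
    [eps]-far from [f]; averaging over [B] keeps this bound. *)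
Lemma eps_le_neg_root (R : realType) (m n k : nat) (eps : R) (f : boolfun m n) :
  (0 < #|cube m n|)%N ->
  far_from_monotone (prod_mass (@uniform R m)) eps f ->
  eps <= 4 * k%:R * (neg_root R f / #|cube m n|%:R) + n%:R / 2 ^+ k.
Proof.
move=> N0 far; set N : R := #|_|%:R; have N0' : 0 < N by rewrite ltr0n.
have : eps * N <= avgs n k (fun B => hamming R f (sort_dirs f (shuffle B (enum 'I_n)))).
  rewrite -[leLHS](avgs_const n k); apply: avgs_le => B.
  rewrite -ler_pdivlMr //; apply: far_le_hamming => //.
  apply: monotone_of_mono_dir => i; apply: mono_sort_dirs.
  by rewrite (perm_mem (perm_shuffle B _)) mem_enum.
move/le_trans=> /(_ _ (avgs_hamming_shuffle R k f (enum_uniq _))).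
rewrite size_enum_ord -/N -ler_pdivlMr // => /le_trans; apply.
rewrite le_eqVlt; apply/orP; left; apply/eqP; field.
by rewrite (gt_eqF N0') ?expf_neq0 // pnatr_eq0.
Qed.

(** * Choice of the number of halvings, and the final bound *)

Lemma ln2_ge_half (R : realType) : 2^-1 <= ln 2 :> R.
Proof.
have := @le_ln1Dx R (- 2^-1).
have -> : 1 + - 2^-1 = 2^-1 :> R by field.
by rewrite lnV ?posrE ?ltr0n // lerN2; apply; lra.
Qed.

Theorem theorem1p3 (R : realType) :
  exists c : R, 0 < c /\
    forall (m n : nat) (eps : R) (f : {ffun cube m n -> bool}),
      0 < eps ->
      far_from_monotone (prod_mass (@uniform R m)) eps f ->
      c * (eps / (m%:R ^+ 3 * (ln ((m * n)%:R / eps)) ^+ 2))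
        <= expect (prod_mass (@uniform R m))
             (fun x => Num.sqrt (neg_sensitivity f x)%:R).
Proof.
exists 8^-1; split=> [|m n eps f e0 far]; first by rewrite invr_gt0 ltr0n.
apply: le_trans (neg_root_le_expect R f); have Phi0 := neg_root_ge0 R f.
case: (posnP n) => [n0|n_gt0].
  (* For [n = 0] the logarithm is [ln 0 = 0] by convention, and division by zero makes the left side
     zero; the case [m = 0] below is similar. *)
  by rewrite [in leLHS]n0 muln0 mul0r ln0 // expr0n mulr0 invr0 !mulr0.
case: m f far Phi0 => [|[|m]] f far Phi0.
- by rewrite expr0n mul0r invr0 !mulr0.
(* For [m = 1] the cube is a single point, so [f] is monotone, against [0 < eps]. *)
- have mf : monotone f.
    apply/forallP=> x; apply/forallP=> y; apply/implyP=> _.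
    by rewrite (_ : x = y) //; apply/ffunP=> i; rewrite !ord1.
  have := far_le_hamming far mf; rewrite /hamming big1 => [|x _].
    by rewrite mul0r leNgt e0.
  by rewrite eqxx.
set Phi := neg_root R f / _ in Phi0 *; have N0 : (0 < #|cube m.+2 n|)%N.
  by rewrite card_ffun !card_ord expn_gt0.
have e1 : eps <= 1.
  apply: le_trans (far_le_hamming far (monotone_false _ _)) _.
  by rewrite ler_pdivrMr ?ltr0n // mul1r hamming_le_card.
set La := ln _; have n1 : 1 <= n%:R :> R by rewrite ler1n.
have m2 : 2 <= m.+2%:R :> R by rewrite ler_nat.
have La_n : ln (2 * n%:R / eps) <= La.
  rewrite ler_ln ?posrE ?divr_gt0 ?mulr_gt0 ?ltr0n ?muln_gt0 //.
  by rewrite ler_pM2r ?invr_gt0 // natrM ler_pM2r // ltr0n.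
have La_half : 2^-1 <= La.
  apply: le_trans (ln2_ge_half R) (le_trans _ La_n).
  rewrite ler_ln ?posrE ?divr_gt0 ?mulr_gt0 ?ltr0n //.
  by rewrite ler_pdivlMr //; nra.
(* Since [ln 2 >= 1 / 2], taking [k >= 2 * La] gives [2 ^+ k >= 2 * n / eps], so the term
   [n / 2 ^+ k] costs at most half of [eps]. *)
have [k k_le k_gt] : exists2 k : nat, k%:R <= 2 * La + 1 & 2 * La <= k%:R.
  have /Num.Theory.truncn_itv/andP[h1 h2] : 0 <= 2 * La by lra.
  by exists (Num.truncn (2 * La)).+1; [rewrite -natr1 lerD2r | exact: ltW].
have pow_k : 2 * n%:R / eps <= 2 ^+ k.
  rewrite -ler_ln ?posrE ?exprn_gt0 ?divr_gt0 ?mulr_gt0 ?ltr0n //.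
  rewrite lnXn ?ltr0n // -[ln 2 *+ k]mulr_natr; apply: le_trans La_n _.
  have := ln2_ge_half R; nra.
have small : n%:R / 2 ^+ k <= eps / 2.
  move: pow_k; rewrite !ler_pdivrMr ?exprn_gt0 ?ltr0n //.
  by rewrite mulrAC ler_pdivlMr ?ltr0n // mulrC [eps * _]mulrC.
have keps : eps <= 8 * k%:R * Phi.
  move: small (eps_le_neg_root k N0 far); rewrite -/Phi -!mulrA.
  move: (k%:R * Phi) (n%:R / _) => p q; lra.
have m3 : 8 <= m.+2%:R ^+ 3 :> R.
  by rewrite -natrX ler_nat -[8%N]/(2 ^ 3)%N leq_exp2r.
(* From [La >= 1 / 2] one gets [2 * La + 1 <= 8 * La ^+ 2], and the factor 8 is at most the cube of
   the side length. *)
have k_le' : k%:R <= m.+2%:R ^+ 3 * La ^+ 2.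
  apply: (@le_trans _ _ (8 * La ^+ 2)); last by rewrite ler_wpM2r ?sqr_ge0.
  by apply: le_trans k_le _; nra.
rewrite mulrA ler_pdivrMr; last first.
  by rewrite mulr_gt0 ?exprn_gt0 ?ltr0n //; lra.
rewrite ler_pdivrMl ?ltr0n //; apply: le_trans keps _.
by rewrite -mulrA ler_pM2l ?ltr0n // mulrC ler_wpM2l.
Qed.
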